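(* Consider the totally quantized gossip algorithm with deterministic quantizer $q_d$: at each time $t$, when the edge $(i,j)$ is selected, $$x_i(t+1)= \tfrac12 q_d(x_i(t))+\tfrac12 q_d(x_j(t)),\qquad x_j(t+1)= \tfrac12 q_d(x_j(t))+\tfrac12 q_d(x_i(t)),$$ and $x_h(t+1)=x_h(t)$ for $h\ne i,j$, starting from a given $x(0)\in\mathbb{R}^N$. Then almost surely there exist $T_{\mathrm{con}}\in\mathbb{Z}_{\ge0}$ and $\alpha\in\mathbb{Z}$ such that $x_i(t)=\alpha$ for all $i\in\mathcal{V}$ and for all $t\ge T_{\mathrm{con}}$.
   Context: Let $\mathcal{G}=(\mathcal{V},\mathcal{E})$ be an undirected connected graph with node set $\mathcal{V}=\{1,\dots,N\}$, whose edges join distinct nodes. At each time $t\in\mathbb{Z}_{\ge0}$ one edge $(i,j)\in\mathcal{E}$ is randomly selected, with probability $W^{(i,j)}>0$, where $\sum_{(i,j)\in\mathcal{E}}W^{(i,j)}=1$; selections at different times are independent. The deterministic quantizer $q_d:\mathbb{R}\to\mathbb{Z}$ sends $z$ to its nearest integer, as follows: $q_d(z)=n\in\mathbb{Z}$ if and only if $z\in[n-1/2,n+1/2)$ when $z\ge0$, and $z\in(n-1/2,n+1/2]$ when $z<0$. *)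

(* Defs.v *)
From HB Require Import structures.
From mathcomp Require Import all_boot all_order all_algebra.
From mathcomp Require Import all_classical all_reals all_analysis.
From mathcomp Require Import lra.

Set Implicit Arguments.
Unset Strict Implicit.
Unset Printing Implicit Defensive.

Import Order.TTheory GRing.Theory Num.Theory.
Import numFieldNormedType.Exports.

Local Open Scope classical_set_scope.
Local Open Scope ring_scope.

Definition q_d (R : realType) (z : R) : int :=
  if 0 <= z then Num.floor (z + 1 / 2) else Num.ceil (z - 1 / 2).

Lemma q_dP (R : realType) (z : R) (n : int) :
  q_d z = n <->
  (if 0 <= z then n%:~R - 1 / 2 <= z < n%:~R + 1 / 2
   else n%:~R - 1 / 2 < z <= n%:~R + 1 / 2).
Proof.
rewrite /q_d; case: ifP => _.
- split=> [<-|/andP[h1 h2]].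
    have := floor_itv (z + 1 / 2) => /andP[]; rewrite intrD; lra.
  by apply: floor_def; rewrite intrD; apply/andP; split; lra.
- split=> [<-|/andP[h1 h2]].
    have := ceil_itv (z - 1 / 2) => /andP[]; rewrite intrB; lra.
  by apply: ceil_def; rewrite intrB; apply/andP; split; lra.
Qed.

(* An undirected edge is the two-element set of its end points. *)
Definition edges (N : nat) (adj : rel 'I_N) : {set {set 'I_N}} :=
  [set [set ij.1; ij.2]%SET | ij in [set ij : 'I_N * 'I_N | adj ij.1 ij.2]%SET]%SET.

Notation edge adj := {a : {set _} | a \in edges adj}.

(* For an edge a, the two ways of writing a as [set i; j] give the same
   constraints, so x' is determined by x and a. *)
Definition gossip_step (R : realType) (N : nat) (a : {set 'I_N})
    (x x' : 'I_N -> R) : Prop :=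
  forall i j : 'I_N, a = [set i; j]%SET ->
  [/\ x' i = 1 / 2 * (q_d (x i))%:~R + 1 / 2 * (q_d (x j))%:~R,
      x' j = 1 / 2 * (q_d (x j))%:~R + 1 / 2 * (q_d (x i))%:~R &
      forall h : 'I_N, h != i -> h != j -> x' h = x h].

Definition mutually_independent (R : realType) (d : measure_display)
    (Omega : measurableType d) (P : probability Omega R) (S : finType)
    (X : nat -> Omega -> S) : Prop :=
  forall (J : seq nat) (B : nat -> set S), uniq J ->
  P (\bigcap_(t in [set` J]) (X t @^-1` B t)) =
  (\prod_(t <- J) P (X t @^-1` B t))%E.

(* Main.v *)
(** The rounded state y = q_d(x) evolves autonomously: an edge {i, j} replaces
    y_i and y_j by round((y_i + y_j) / 2), half-integers being rounded away
    from zero.  From every y some word of edges leads to consensus.  As long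
    as both signs occur, average across an edge joining a negative and a
    nonnegative node: the result is below the nonnegative value, so the sum of
    3 ^ y_i over nonnegative y_i drops.  Once all values have one sign, use any
    discordant edge: the result is strictly nearer to the extreme value of that
    sign than the farther of the two, so a similar sum of powers of 3 drops.
    Consensus is absorbing and the bounded integer states are finite in number,
    so concatenating such words yields one word that brings all of them to
    consensus at once.  Since this word does not depend on the state, no Markov
    property is needed: followed by a listing of all edges (after which x itself
    is constant), it almost surely occurs in the independent selections. *)

Require Import Defs.
From HB Require Import structures.
From mathcomp Require Import all_boot all_order all_algebra.
From mathcomp Require Import all_classical all_reals all_analysis.
From mathcomp Require Import zify lra.

Set Implicit Arguments.
Unset Strict Implicit.

Import Order.TTheory GRing.Theory Num.Theory.
Import numFieldNormedType.Exports.

Local Open Scope classical_set_scope.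
Local Open Scope ring_scope.

(** * Rounding the mean of two integers *)

Section Quantizer.
Context (R : realType).

Definition round_half (s : int) : int := q_d (s%:~R / 2 : R).

(** Doubling the bounds of [q_dP] leaves linear inequalities over the integers, within reach of
    [lia]. *)
Lemma round_halfP (s : int) :
  if 0 <= s then 2 * round_half s - 1 <= s < 2 * round_half s + 1
  else 2 * round_half s - 1 < s <= 2 * round_half s + 1.
Proof.
have /q_dP := erefl (round_half s).
have -> : (0 <= s%:~R / 2 :> R) = (0 <= s) by rewrite -(ler0z R); apply/idP/idP; lra.
by case: ifP => _ /andP[h1 h2]; apply/andP; split;
  rewrite -?(ler_int R) -?(ltr_int R) ?rmorphD ?rmorphB ?rmorphM /=; lra.
Qed.

Lemma q_d_mean (m n : int) :
  q_d (1 / 2 * m%:~R + 1 / 2 * n%:~R : R) = round_half (m + n).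
Proof. by rewrite /round_half rmorphD /=; congr q_d; lra. Qed.

End Quantizer.

(** * The autonomous dynamics of the rounded state *)

Section GossipDynamics.
Context (R : realType) (N : nat) (adj : rel 'I_N).
Hypotheses (adj_sym : symmetric adj) (adj_irr : irreflexive adj)
  (adj_conn : forall i j : 'I_N, connect adj i j).

Implicit Types (y : {ffun 'I_N -> int}) (a : edge adj) (w : seq (edge adj)).

(** Summing over the edge as a set avoids ordering its end points. *)
Definition qstep (y : {ffun 'I_N -> int}) (a : edge adj) : {ffun 'I_N -> int} :=
  [ffun i => if i \in val a then round_half R (\sum_(j in val a) y j) else y i].

Definition run := foldl qstep.

Lemma edgeE (a : edge adj) : exists i j, [/\ i != j & val a = [set i; j]%SET].
Proof.
case: a => a /=; move/imsetP => [[i j]]; rewrite inE /= => ij ->.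
by exists i, j; split=> //; apply: contraTneq ij => ->; rewrite adj_irr.
Qed.

Lemma adj_edge i j : adj i j -> exists a : edge adj, val a = [set i; j]%SET.
Proof.
move=> ij; have ea : [set i; j]%SET \in edges adj.
  by apply/imsetP; exists (i, j); rewrite ?inE.
by exists (exist (fun b : {set _} => b \in edges adj) _ ea).
Qed.

Lemma qstepE y (a : edge adj) i j : i != j -> val a = [set i; j]%SET ->
  forall h, qstep y a h =
    if (h == i) || (h == j) then round_half R (y i + y j) else y h.
Proof.
by move=> ij ea h; rewrite ffunE ea !inE big_setU1 ?big_set1 ?inE.
Qed.

Lemma qstep_between (lo hi : int) y a :
  (forall i, lo <= y i <= hi) -> forall i, lo <= qstep y a i <= hi.
Proof.
move=> yb h; have [i [j [ij ea]]] := edgeE a; rewrite (qstepE y ij ea).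
case: ifP => // _; have := yb i; have := yb j.
have := round_halfP R (y i + y j); case: ifP; lia.
Qed.

Lemma run_between (lo hi : int) y w :
  (forall i, lo <= y i <= hi) -> forall i, lo <= run y w i <= hi.
Proof. by elim: w y => //= a w IH y yb; apply/IH/qstep_between. Qed.

(** * Words of edges that reach consensus *)

Definition consensus (y : {ffun 'I_N -> int}) : Prop := exists c, forall i, y i = c.

Lemma run_consensus y w : consensus y -> consensus (run y w).
Proof.
move=> [c yc]; exists c => i; apply/eqP.
rewrite eq_le andbC; apply: (@run_between c c y w) => k.
by rewrite yc lexx.
Qed.

(** If no edge left [p], then [p] would be closed under adjacency, and connectedness would carry it
    from [i] to [j]. *)
Lemma cut_edge (p : pred 'I_N) i j : p i -> ~~ p j ->
  exists u v (a : edge adj), [/\ p u, ~~ p v, u != v & val a = [set u; v]%SET].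
Proof.
move=> pi pj.
have [/existsP[u /existsP[v /and3P[uv pu pv]]]|no] :=
  boolP [exists u, exists v, [&& adj u v, p u & ~~ p v]].
  have [a ea] := adj_edge uv; exists u, v, a; split=> //.
  by apply: contraTneq pu => ->.
have cl : fingraph.closed adj p.
  apply: intro_closed => [|u v uv pu]; first exact: sym_connect_sym.
  by apply: contraNT no => pv; apply/existsP; exists u; apply/existsP; exists v; apply/and3P.
by move: pj; rewrite -[p j]/(j \in p) -(closed_connect cl (adj_conn i j)) [_ \in _]pi.
Qed.

Lemma qstep_potential (phi : int -> nat) y (a : edge adj) u v :
  u != v -> val a = [set u; v]%SET ->
  (2 * phi (round_half R (y u + y v)) < phi (y u) + phi (y v))%N ->
  (\sum_i phi (qstep y a i) < \sum_i phi (y i))%N.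
Proof.
move=> uv ea lt.
rewrite (bigD1 u) //= (bigD1 v) /=; last by rewrite eq_sym.
rewrite [ltnRHS](bigD1 u) //= [X in (_ < _ + X)%N](bigD1 v) /=; last by rewrite eq_sym.
rewrite !(qstepE y uv ea) !eqxx /= orbT.
rewrite (eq_bigr (fun i => phi (y i))); first by rewrite !addnA ltn_add2r addnn -mul2n.
by move=> i /andP[iu iv]; rewrite (qstepE y uv ea) (negPf iu) (negPf iv).
Qed.

Lemma run_descent (Inv Goal : {ffun 'I_N -> int} -> Prop)
    (V : {ffun 'I_N -> int} -> nat) :
  (forall y, Inv y -> Goal y \/
     exists a, Inv (qstep y a) /\ (V (qstep y a) < V y)%N) ->
  forall y, Inv y -> exists w, Goal (run y w).
Proof.
move=> step y; have [n] := ubnP (V y).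
elim: n y => // n IH y lt Iy; case: (step y Iy) => [Gy|[a [Ia Va]]].
  by exists [::].
have [|w Gw] := IH (qstep y a) _ Ia; last by exists (a :: w).
by apply: leq_trans Va _.
Qed.

Lemma consensus_or_discordant y : consensus y \/
  exists u v a, [/\ y u != y v, u != v & val a = [set u; v]%SET].
Proof.
have [/existsP[i /existsP[j ij]]|no] := boolP [exists i, exists j, y i != y j].
  have [u [v [a [/= /eqP yu yv uv ea]]]] :=
    @cut_edge (fun k => y k == y j) j i (eqxx _) ij.
  by right; exists u, v, a; split=> //; rewrite yu eq_sym.
left; case: (pickP (fun i : 'I_N => true)) => [i _|none].
  exists (y i) => j; apply/eqP; apply: contraNT no => ji.
  by apply/existsP; exists j; apply/existsP; exists i.
by exists 0 => i; have := none i.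
Qed.

(** Both end points take the new value, so one old term must outweigh two new ones; base 2 would
    only give equality when [n = m + 1]. *)
Lemma pow3_drop (m n : nat) : (m < n)%N -> (2 * 3 ^ m < 3 ^ n)%N.
Proof.
move=> mn; apply: (@leq_trans (3 ^ m.+1)%N); last by rewrite leq_exp2l.
by rewrite expnS ltn_pmul2r ?expn_gt0.
Qed.

(** Nonnegative halves round up, so the new value exceeds the smaller of two discordant ones and is
    strictly closer to [B]. *)
Lemma run_nonneg (B : int) y :
  (forall i, 0 <= y i <= B) -> exists w, consensus (run y w).
Proof.
apply: (@run_descent (fun y => forall i, 0 <= y i <= B) _
  (fun y => \sum_i 3 ^ `|B - y i|)%N) => {}y yb.
have [|[u [v [a [yuv uv ea]]]]] := consensus_or_discordant y; [by left | right].
exists a; split; first exact: qstep_between.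
apply: (qstep_potential (phi := fun z => (3 ^ `|B - z|)%N) uv ea).
have := yb u; have := yb v.
have := round_halfP R (y u + y v); case: ifP; last by lia.
set c := round_half _ _ => _ cP bv bu.
have [lt|lt] : y u < c \/ y v < c by lia.
- apply: leq_trans (leq_addr _ _); apply: pow3_drop; lia.
- apply: leq_trans (leq_addl _ _); apply: pow3_drop; lia.
Qed.

(** Mirror image: discordant nonpositive values have a negative sum, so halves round down, below the
    larger value. *)
Lemma run_nonpos (B : int) y :
  (forall i, B <= y i <= 0) -> exists w, consensus (run y w).
Proof.
apply: (@run_descent (fun y => forall i, B <= y i <= 0) _
  (fun y => \sum_i 3 ^ `|y i - B|)%N) => {}y yb.
have [|[u [v [a [yuv uv ea]]]]] := consensus_or_discordant y; [by left | right].
exists a; split; first exact: qstep_between.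
apply: (qstep_potential (phi := fun z => (3 ^ `|z - B|)%N) uv ea).
have := yb u; have := yb v.
have := round_halfP R (y u + y v).
set c := round_half _ _ => cP bv bu.
have [cB [lt|lt]] : B <= c /\ (c < y u \/ c < y v) by move: cP; case: ifP; lia.
- apply: leq_trans (leq_addr _ _); apply: pow3_drop; lia.
- apply: leq_trans (leq_addl _ _); apply: pow3_drop; lia.
Qed.

Lemma run_same_sign y :
  exists w, (forall i, 0 <= run y w i) \/ (forall i, run y w i <= 0).
Proof.
pose Goal y := (forall i, 0 <= y i) \/ (forall i, y i <= 0).
pose V y := (\sum_i (if (0 <= y i)%R then 3 ^ `|y i| else 0))%N.
apply: (@run_descent (fun=> True) Goal V) => // {}y _.
have [/forallP|] := boolP [forall i, 0 <= y i]; first by left; left.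
have [/forallP|] := boolP [forall i, y i <= 0]; first by left; right.
rewrite !negb_forall => /existsP[i yi] /existsP[j yj]; right.
have {}yi : 0 <= y i by lia.
have [u [v [a [/= yu yv uv ea]]]] := @cut_edge (fun k => 0 <= y k) i j yi yj.
exists a; split=> //.
apply: (qstep_potential (phi := fun z => if 0 <= z then (3 ^ `|z|)%N else 0%N) uv ea).
rewrite yu (negPf yv) addn0.
(* The case of [0] next to [-1] depends on rounding away from zero: the mean -1/2 becomes [-1]. *)
have : round_half R (y u + y v) < y u.
  by have := round_halfP R (y u + y v); case: ifP; lia.
case: ifP => [c0 lt|_ _]; first by apply: pow3_drop; lia.
by rewrite muln0 expn_gt0.
Qed.

Lemma run_cat y w w' : run y (w ++ w') = run (run y w) w'.
Proof. exact: foldl_cat. Qed.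

Lemma run_to_consensus y : exists w, consensus (run y w).
Proof.
pose B : int := Posz (\sum_i `|y i|)%N.
have yB i : - B <= y i <= B.
  have : (`|y i| <= \sum_i `|y i|)%N by rewrite (bigD1 i) //= leq_addr.
  rewrite /B; lia.
have [w sgn] := run_same_sign y; have wB := run_between w yB.
have [w' cw'] : exists w', consensus (run (run y w) w').
  case: sgn => sgn; [apply: (@run_nonneg B) | apply: (@run_nonpos (- B))] => i;
  have := wB i; have := sgn i; lia.
by exists (w ++ w'); rewrite run_cat.
Qed.

Lemma synchronizing_word (ys : seq {ffun 'I_N -> int}) :
  exists w, forall y, y \in ys -> consensus (run y w).
Proof.
elim: ys => [|y ys [w IH]]; first by exists [::].
have [w' cw'] := run_to_consensus (run y w).
exists (w ++ w') => z; rewrite inE run_cat => /predU1P[->|/IH] //.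
exact: run_consensus.
Qed.

Lemma bounded_synchronizing_word (B : nat) :
  exists w, forall y, (forall i, (`|y i| <= B)%N) -> consensus (run y w).
Proof.
(* Shifting by [B] makes the bounded states the image of a finite type. *)
pose dec (f : {ffun 'I_N -> 'I_(2 * B).+1}) : {ffun 'I_N -> int} :=
  [ffun i => Posz (f i) - Posz B].
have [w sw] := synchronizing_word [seq dec f | f : {ffun 'I_N -> 'I_(2 * B).+1}].
exists w => y yB; apply: sw.
suff -> : y = dec [ffun i => inord (absz (y i + Posz B))] by rewrite map_f ?mem_enum.
apply/ffunP => i; rewrite !ffunE; have := yB i; move: (y i) => z zB.
by rewrite inordK; lia.
Qed.

(** * From the rounded state back to the real one *)

Definition quantize (z : 'I_N -> R) : {ffun 'I_N -> int} := [ffun i => q_d (z i)].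

Lemma gossip_quantize (a : edge adj) (z z' : 'I_N -> R) :
  gossip_step (val a) z z' -> quantize z' = qstep (quantize z) a.
Proof.
have [i [j [ij ea]]] := edgeE a => /(_ i j ea)[zi zj zh]; apply/ffunP => h.
rewrite (qstepE _ ij ea) !ffunE; have [->|hi] := eqVneq h i.
  by rewrite zi q_d_mean.
have [->|hj] := eqVneq h j; first by rewrite zj q_d_mean addrC.
by rewrite zh.
Qed.

Lemma gossip_agree (a : edge adj) (z z' : 'I_N -> R) (c : int) :
  gossip_step (val a) z z' -> (forall i, quantize z i = c) ->
  forall h, z' h = if h \in val a then c%:~R else z h.
Proof.
have [i [j [ij ea]]] := edgeE a => /(_ i j ea)[zi zj zh] zc h.
have qc k : q_d (z k) = c by rewrite -(zc k) ffunE.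
rewrite ea !inE; have [->|hi] := eqVneq h i; first by rewrite zi !qc; lra.
by have [->|hj] := eqVneq h j; [rewrite zj !qc; lra | rewrite zh].
Qed.

Section Trajectory.
Context (s : nat -> edge adj) (z : nat -> 'I_N -> R).
Hypothesis z_step : forall t, gossip_step (val (s t)) (z t) (z t.+1).

Lemma trajectory_run a0 w T :
  (forall k, (k < size w)%N -> s (T + k)%N = nth a0 w k) ->
  quantize (z (T + size w)%N) = run (quantize (z T)) w.
Proof.
elim: w T => [|a w IH] T sw; first by rewrite addn0.
rewrite /= addnS -addSn IH => [|k kw]; last by rewrite addSnnS sw.
by rewrite (gossip_quantize (@z_step T)) -[T in s T]addn0 sw.
Qed.

Lemma trajectory_between (lo hi : int) T :
  (forall i, lo <= quantize (z T) i <= hi) ->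
  forall t, (T <= t)%N -> forall i, lo <= quantize (z t) i <= hi.
Proof.
move=> zT; elim=> [|t IH].
  by rewrite leqn0 => /eqP T0; rewrite T0 in zT.
rewrite leq_eqVlt => /predU1P[<- //|/IH zt].
by rewrite (gossip_quantize (@z_step t)); exact: qstep_between.
Qed.

(** Equal roundings do not yet make the real values equal. The selection at time [T] sets node [i]
    to [c] exactly, and later averages of [c] with [c] keep it there. *)
Lemma trajectory_agree (c : int) T0 T i :
  (forall j, quantize (z T0) j = c) -> (T0 <= T)%N -> i \in val (s T) ->
  forall t, (T < t)%N -> z t i = c%:~R.
Proof.
move=> zc T0T iT.
have agree t : (T0 <= t)%N -> forall j, quantize (z t) j = c.
  move=> T0t j; apply/eqP; rewrite eq_le andbC.
  by apply: (trajectory_between (T := T0)) => // k; rewrite zc lexx.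
elim=> // t IH; rewrite ltnS leq_eqVlt => /predU1P[<-|Tt].
  by rewrite (gossip_agree (@z_step T) (agree T T0T)) iT.
rewrite (gossip_agree (@z_step t) (agree t _)); last by lia.
by case: ifP => // _; exact: IH.
Qed.

End Trajectory.

(** The edge [a0] provides a second node, and some edge separates [i] from the rest. *)
Lemma incident_edge (a0 : edge adj) i : exists a : edge adj, i \in val a.
Proof.
have [u [v [uv _]]] := edgeE a0.
have [j ji] : exists j, j != i.
  by have [ui|ui] := eqVneq u i; [exists v; rewrite -ui eq_sym | exists u].
have [k [l [a [/= /eqP -> _ _ ea]]]] := @cut_edge (pred1 i) i j (eqxx _) ji.
by exists a; rewrite ea !inE eqxx.
Qed.

End GossipDynamics.

(** * Occurrence of a fixed word in independent selections *)

Section HittingWord.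
Context (R : realType) (d : measure_display) (Omega : measurableType d)
  (P : probability Omega R) (S : finType) (X : nat -> Omega -> S).
Hypotheses (X_meas : forall t B, measurable (X t @^-1` B))
  (X_indep : mutually_independent P X).
Context (u : nat -> S) (L : nat) (p : R).

(** The word is sought only in the disjoint windows from [n * L] to [n * L + L - 1], so that
    different blocks constrain different selections. *)
Definition block (n : nat) : set Omega :=
  \bigcap_(t in [set` iota (n * L) L]) X t @^-1` [set u (t - n * L)%N].

Fixpoint miss (n : nat) : set Omega :=
  if n is m.+1 then miss m `\` block m else setT.

Lemma bigcap_meas (J : seq nat) (B : nat -> set S) :
  measurable (\bigcap_(t in [set` J]) (X t @^-1` B t)).
Proof. by apply: bigcap_measurableType => t _; exact: X_meas. Qed.

Lemma block_meas n : measurable (block n).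
Proof. exact: (bigcap_meas _ (fun t => [set u (t - n * L)%N])). Qed.

Lemma miss_meas n : measurable (miss n).
Proof.
elim: n => [|n IH] /=; first exact: measurableT.
by apply: measurableD => //; exact: block_meas.
Qed.

Hypothesis block_prob : forall n, P (block n) = p%:E.

(* Stated jointly with arbitrary later constraints so that the induction goes
   through. *)
Lemma miss_indep n (J : seq nat) (B : nat -> set S) :
  uniq J -> (forall t, t \in J -> (n * L <= t)%N) ->
  P (miss n `&` \bigcap_(t in [set` J]) (X t @^-1` B t)) =
  (((1 - p) ^+ n)%:E * P (\bigcap_(t in [set` J]) (X t @^-1` B t)))%E.
Proof.
elim: n J B => [|n IH] J B uJ geJ /=.
  by rewrite setTI expr0 mul1e.
set F := \bigcap_(t in _) _.
have mF : measurable F by exact: bigcap_meas.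
have -> : (miss n `\` block n) `&` F = (miss n `&` F) `\` block n.
  by apply/seteqP; split => w /=; tauto.
rewrite measureD; last 3 first.
- exact: measurableI (miss_meas n) mF.
- exact: block_meas.
- by rewrite ltey_eq fin_num_measure //; exact: measurableI (miss_meas n) mF.
(* One family of constraints covers both the window and the later times in [J], as [X_indep]
   requires. *)
pose C t := if (t < n.+1 * L)%N then [set u (t - n * L)%N] else B t.
have geJ' t : t \in J -> (n * L + L <= t)%N.
  by move=> /geJ; rewrite mulSn addnC.
have eb : block n = \bigcap_(t in [set` iota (n * L) L]) (X t @^-1` C t).
  apply: eq_bigcapr => t /=; rewrite mem_iota => /andP[_ lt].
  by rewrite /C mulSn addnC lt.
have eF : F = \bigcap_(t in [set` J]) (X t @^-1` C t).
  apply: eq_bigcapr => t /= /geJ' ge.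
  by rewrite /C mulSn addnC ltnNge ge.
have uIJ : uniq (iota (n * L) L ++ J).
  rewrite cat_uniq iota_uniq uJ /= andbT; apply/hasPn => t /geJ' ge.
  by rewrite mem_iota negb_and -!leqNgt ge orbT.
have ebF : block n `&` F =
    \bigcap_(t in [set` iota (n * L) L ++ J]) (X t @^-1` C t).
  rewrite eb eF -bigcap_setU; congr bigcap; apply/seteqP.
  by split => t /=; rewrite mem_cat => /orP.
have -> : miss n `&` F `&` block n = miss n `&` (block n `&` F).
  by rewrite -setIA (setIC F).
have PbF : P (block n `&` F) = (p%:E * P F)%E.
  by rewrite ebF X_indep // big_cat /= -!X_indep ?iota_uniq // -eb -eF block_prob.
(* The induction hypothesis applies to both terms, the second with the window added to [J]; the
   difference has the factor [(1 - p) ^+ n * (1 - p)]. *)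
transitivity (P (miss n `&` F) - P (miss n `&` (block n `&` F)))%E; first by [].
have -> : P (miss n `&` F) = (((1 - p) ^+ n)%:E * P F)%E.
  by apply: IH => // t /geJ'; lia.
rewrite ebF IH //; last first.
  by move=> t; rewrite mem_cat mem_iota => /orP[/andP[]|/geJ'] //; lia.
rewrite -ebF PbF -/F.
rewrite -(@fineK _ (P F)) ?fin_num_measure //.
rewrite -!EFinM -EFinB; congr EFin; rewrite exprS; lra.
Qed.

(** Missing all blocks has probability at most [(1 - p) ^+ n] for every [n], hence zero. *)
Lemma ae_hit_block : 0 < p -> {ae P, forall w, exists n, block n w}.
Proof.
move=> p0.
have p1 : p <= 1 by rewrite -lee_fin -(block_prob 0) probability_le1 //; exact: block_meas.
have mI : measurable (\bigcap_n miss n).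
  by apply: bigcap_measurableType => n _; exact: miss_meas.
exists (\bigcap_n miss n); split => //.
- have Pn n : P (miss n) = ((1 - p) ^+ n)%:E.
    have := @miss_indep n [::] (fun=> setT) isT (fun _ => ltac:(done)).
    by rewrite set_nil bigcap_set0 setIT probability_setT mule1.
  have le n : (P (\bigcap_n miss n) <= ((1 - p) ^+ n)%:E)%E.
    rewrite -Pn le_measure ?inE //; first exact: miss_meas.
    by move=> w; apply.
  apply/eqP; rewrite eq_le measure_ge0 andbT.
  rewrite -(@fineK _ (P _)) ?fin_num_measure // lee_fin.
  have lt1 : `|1 - p| < 1 by rewrite ger0_norm ?subr_ge0 //; lra.
  apply: (cvgr_to_ge (cvg_expr lt1)); apply: nearW => n.
  by rewrite -lee_fin fineK ?fin_num_measure.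
- move=> w /= nh n _; elim: n => //= n IH; split=> // bn.
  by apply: nh; exists n.
Qed.

End HittingWord.

(** By independence every block has the same probability, the positive product of the weights of its
    letters. *)
Lemma ae_hit_word (R : realType) (d : measure_display)
    (Omega : measurableType d) (P : probability Omega R) (S : finType)
    (X : nat -> Omega -> S) (W : S -> R) (u : nat -> S) (L : nat) :
  (forall t B, measurable (X t @^-1` B)) -> mutually_independent P X ->
  (forall t s, P (X t @^-1` [set s]) = (W s)%:E) -> (forall s, 0 < W s) ->
  {ae P, forall w, exists T, forall k, (k < L)%N -> X (T + k)%N w = u k}.
Proof.
move=> mX iX lX W0.
have Pb n : P (block X u L n) = (\prod_(0 <= k < L) W (u k))%:E.
  rewrite (iX _ (fun t => [set u (t - n * L)%N])) ?iota_uniq //.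
  rewrite -prodEFin (eq_bigr _ (fun t _ => lX t _)) -{1}[(n * L)%N]addn0 iotaDl.
  rewrite big_map /index_iota subn0; apply: eq_bigr => k _.
  by rewrite addKn.
apply: filterS (ae_hit_block mX iX Pb _); last by apply: prodr_gt0.
move=> w [n bn]; exists (n * L)%N => k kL.
have := bn (n * L + k)%N; rewrite /= addKn; apply.
by rewrite mem_iota; lia.
Qed.

Unset Implicit Arguments.
Set Strict Implicit.

Theorem corollary4p2 (R : realType) (N : nat) (adj : rel 'I_N)
    (adj_sym : symmetric adj) (adj_irr : irreflexive adj)
    (adj_conn : forall i j : 'I_N, connect adj i j)
    (W : edge adj -> R) (W_gt0 : forall a : edge adj, 0 < W a)
    (W_sum : \sum_(a : edge adj) W a = 1)
    (d : measure_display) (Omega : measurableType d) (P : probability Omega R)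
    (sel : nat -> Omega -> edge adj)
    (sel_meas : forall (t : nat) (B : set (edge adj)),
       measurable (sel t @^-1` B))
    (sel_law : forall (t : nat) (a : edge adj),
       P (sel t @^-1` [set a]) = (W a)%:E)
    (sel_indep : mutually_independent P sel)
    (x0 : 'I_N -> R) (x : nat -> Omega -> 'I_N -> R)
    (x_init : forall (w : Omega) (i : 'I_N), x 0%N w i = x0 i)
    (x_step : forall (t : nat) (w : Omega),
       gossip_step (val (sel t w)) (x t w) (x t.+1 w)) :
  {ae P, forall w : Omega, exists (T_con : nat) (alpha : int),
     forall (i : 'I_N) (t : nat), (T_con <= t)%N -> x t w i = alpha%:~R}.
Proof.
(* Without edges the weights would sum to zero. *)
have [a0 _] : exists a0 : edge adj, true.
  case: (pickP (fun _ : edge adj => true)) => [a0 _|none]; first by exists a0.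
  by move: W_sum; rewrite big_pred0 // => /eqP; rewrite eq_sym oner_eq0.
pose B := (\sum_i `|(q_d (x0 i) : int)|)%N.
have x0B i : (`|(q_d (x0 i) : int)| <= B)%N by rewrite /B (bigD1 i) //= leq_addr.
have [w sync] := bounded_synchronizing_word R adj_sym adj_irr adj_conn B.
(* [w] makes the roundings agree; the listing then touches every node. *)
pose v := w ++ enum {: edge adj}.
apply: filterS (ae_hit_word (nth a0 v) (size v) sel_meas sel_indep sel_law W_gt0).
move=> om [T hit].
have step t := x_step t om.
have [c xc] : consensus (quantize (x (T + size w)%N om)).
  rewrite (trajectory_run adj_irr step (a0 := a0) (w := w)); last first.
    by move=> k kw; rewrite hit /v ?nth_cat ?kw // size_cat ltn_addr.
  apply: sync => i.
  (* The time [T] is random, but the rounded state never leaves its initial bounds, so [w] still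
     synchronizes it. *)
  have : - Posz B <= quantize (x T om) i <= Posz B; last by lia.
  apply: (trajectory_between adj_irr step (T := 0)) => // j.
  by rewrite ffunE x_init; have := x0B j; lia.
exists (T + size v)%N, c => i t tT.
have [a ia] := incident_edge adj_sym adj_irr adj_conn a0 i.
have ka : (index a (enum {: edge adj}) < size (enum {: edge adj}))%N.
  by rewrite index_mem mem_enum.
(* This is the time at which [a] is selected within the listing, strictly before [T + size v]. *)
apply: (trajectory_agree adj_irr step xc
  (T := (T + (size w + index a (enum {: edge adj})))%N)); first by lia.
- rewrite hit /v; last by rewrite size_cat ltn_add2l.
  by rewrite nth_cat ltnNge leq_addr addKn nth_index ?mem_enum.
- by apply: leq_trans tT; rewrite /v size_cat ltn_add2l ltn_add2l.
Qed.
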